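(* Let $W$ be a finite reflection group of type A, B or D acting on $V=\mathbb{R}^\ell$, that is, $W=W^A$ or $W=W^B$ with $\ell\ge2$, or $W=W^D$ with $\ell\ge 4$, and let $\mathscr{A}$ be the corresponding reflection arrangement ($\mathcal{A}_{\ell-1}$, $\mathcal{B}_\ell$ or $\mathcal{D}_\ell$ respectively). Then the $S$-module $D^{(2)}(\mathscr{A})$ cannot have bases (over $S$) consisting of only $W$-invariant elements.
   Context: $S=\mathbb{R}[x_1,\dots,x_\ell]$ is the ring of polynomial functions on $V=\mathbb{R}^\ell$, $\partial_i=\partial/\partial x_i$, and $D^{(2)}(S)=\bigoplus_{|\alpha|=2}S\,\partial^\alpha$ (multi-indices $\alpha\in\mathbb{N}^\ell$ with $\alpha_1+\cdots+\alpha_\ell=2$). For a central arrangement $\mathscr{A}$ with defining polynomial $Q$, $D^{(2)}(\mathscr{A})=\{\theta\in D^{(2)}(S)\mid\theta(QS)\subseteq QS\}$. Here $Q(\mathcal{A}_{\ell-1})=\prod_{i<j}(x_i-x_j)$, $Q(\mathcal{B}_\ell)=x_1\cdots x_\ell\prod_{i<j}(x_i^2-x_j^2)$, $Q(\mathcal{D}_\ell)=\prod_{i<j}(x_i^2-x_j^2)$. The groups are $W^A=\mathfrak{S}_\ell$ (permuting the coordinates of $\mathbb{R}^\ell$), $W^B=\mathfrak{S}_\ell\ltimes(\mathbb{Z}/2\mathbb{Z})^\ell$ (permutations and arbitrary sign changes of coordinates), and $W^D=\mathfrak{S}_\ell\ltimes(\mathbb{Z}/2\mathbb{Z})^{\ell-1}$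 (permutations and sign changes of an even number of coordinates). $W$ acts on $S$ by $(w\cdot f)(v)=f(w^{-1}v)$ and on $D^{(2)}(S)$ by $(w\cdot\theta)(f)=w\cdot(\theta(w^{-1}\cdot f))$; an element $\theta$ is $W$-invariant if $w\cdot\theta=\theta$ for all $w\in W$. *)

(* Defs.v *)
From HB Require Import structures.
From mathcomp Require Import all_boot all_order all_algebra all_fingroup.
From mathcomp Require Import reals.
From mathcomp Require Import mpoly.

Set Implicit Arguments.
Unset Strict Implicit.
Unset Printing Implicit Defensive.

Import Order.TTheory GRing.Theory Num.Theory.
Local Open Scope ring_scope.

(* Bases of an arbitrary (possibly infinite) cardinality: [B] is a basis of the
   submodule [N] of [M]. *)
Definition is_basis (A : pzRingType) (M : lmodType A) (N B : M -> Prop) : Prop :=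
  [/\ forall b, B b -> N b,
      forall x, N x ->
        exists (s : seq M) (c : M -> A),
          (forall b, b \in s -> B b) /\ x = \sum_(b <- s) c b *: b
    & forall (s : seq M) (c : M -> A),
        uniq s -> (forall b, b \in s -> B b) ->
        \sum_(b <- s) c b *: b = 0 -> forall b, b \in s -> c b = 0].

Inductive reflection_type := TypeA | TypeB | TypeD.

Definition min_dim (t : reflection_type) : nat :=
  match t with TypeA | TypeB => 2%N | TypeD => 4%N end.

Section Defs.
Variables (R : realType) (l : nat).

Local Notation S := {mpoly R[l]}.

(* (w . f)(v) = f (w^-1 v) for column vectors v; see [lin_act_meval]. *)
Definition lin_act (w : 'M[R]_l) (f : S) : S :=
  f \mPo [tuple \sum_j invmx w i j *: 'X_j | i < l].

Lemma lin_act_meval (w : 'M[R]_l) (f : S) (v : 'cV[R]_l) :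
  (lin_act w f).@[fun i => v i 0] = f.@[fun i => (invmx w *m v) i 0].
Proof.
rewrite comp_mpoly_meval; apply: meval_eq => i.
rewrite tnth_mktuple raddf_sum mxE; apply: eq_bigr => j _.
by rewrite /= mevalZ mevalXU.
Qed.

Definition multi_index2 := {a : 'X_{1..l < 3} | mdeg a == 2%N}.

(* An operator of D^(2)(S) is given by its coefficients on the free S-basis
   (d^a)_(|a| = 2). *)
Definition D2S := {ffun multi_index2 -> S^o}.

Definition diffop (theta : D2S) (f : S) : S :=
  \sum_(a : multi_index2) (theta a : S) * f^`M[val (val a)].

(* Distinct coefficient families define distinct operators on S, so that
   equality in D^(2)(S) may be tested on operators. *)
Lemma diffop_inj (theta eta : D2S) : diffop theta =1 diffop eta -> theta = eta.
Proof.
move=> eq_op; apply/ffunP => a.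
have key (z : D2S) :
    diffop z 'X_[val (val a)] =
      (z a : S) * ((\prod_(i < l) (val (val a) i)`!)%N%:R)%:MP.
  rewrite /diffop (bigD1 a) //= [X in _ + X]big1 ?addr0 => [|b neq_ba].
    rewrite mderivmX; have -> : (val (val a) - val (val a) = 0)%MM.
      by apply/mnmP => i; rewrite mnmBE mnm0E subnn.
    rewrite mpolyX0 -mul_mpolyC mulr1; congr (_ * (_%:R)%:MP).
    by apply: eq_bigr => i _; rewrite ffactnn.
  rewrite mderivmX.
  suff /existsP[i lt_i] : [exists i, (val (val a) i < val (val b) i)%N].
    by rewrite (bigD1 i) //= ffact_small // mul0n scale0r mulr0.
  apply: contraNT neq_ba => /existsPn ge_ab.
  have le_ba : (val (val b) <= val (val a))%MM.
    by apply/mnm_lepP => i; rewrite leqNgt ge_ab.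
  have eq_a := submK le_ba.
  have : mdeg (val (val a) - val (val b))%MM == 0%N.
    have := congr1 mdeg eq_a; rewrite mdegD.
    by rewrite (eqP (valP a)) (eqP (valP b)) => /(canRL (addnK _)) ->.
  rewrite mdeg_eq0 => /eqP eq0; apply/eqP/val_inj/val_inj.
  by rewrite -eq_a eq0 add0m.
have := eq_op 'X_[val (val a)]; rewrite !key => /mulIf; apply.
rewrite mpolyC_eq pnatr_eq0 -lt0n; apply: prodn_gt0 => i; exact: fact_gt0.
Qed.

Definition op_act (w : 'M[R]_l) (T : S -> S) : S -> S :=
  fun f => lin_act w (T (lin_act (invmx w) f)).

Definition invariant_op (W : 'M[R]_l -> Prop) (theta : D2S) : Prop :=
  forall w, W w -> op_act w (diffop theta) =1 diffop theta.

Definition D2 (Q : S) (theta : D2S) : Prop :=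
  forall f, exists g, diffop theta (Q * f) = Q * g.

Definition signed_perm_mx (s : 'S_l) (E : {set 'I_l}) : 'M[R]_l :=
  perm_mx s *m diag_mx (\row_i (-1) ^+ (i \in E)).

Definition reflection_group (t : reflection_type) (w : 'M[R]_l) : Prop :=
  match t with
  | TypeA => exists s : 'S_l, w = perm_mx s
  | TypeB => exists (s : 'S_l) (E : {set 'I_l}), w = signed_perm_mx s E
  | TypeD => exists (s : 'S_l) (E : {set 'I_l}),
               ~~ odd #|E| /\ w = signed_perm_mx s E
  end.

Definition defining_poly (t : reflection_type) : S :=
  match t with
  | TypeA => \prod_(i < l) \prod_(j < l | (i < j)%N) ('X_i - 'X_j)
  | TypeB => (\prod_(i < l) 'X_i) *
             \prod_(i < l) \prod_(j < l | (i < j)%N) ('X_i ^+ 2 - 'X_j ^+ 2)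
  | TypeD => \prod_(i < l) \prod_(j < l | (i < j)%N) ('X_i ^+ 2 - 'X_j ^+ 2)
  end.

End Defs.

(* Main.v *)
Require Import Defs.
From mathcomp Require Import all_boot all_order all_algebra all_fingroup.
From mathcomp Require Import reals.
From mathcomp Require Import mpoly.
From mathcomp Require Import ring zify.

(** Let [s] be the reflection exchanging the first two coordinates; it belongs to
    all the groups considered. Put [a = x_0 - x_1], so that [Q = a Q'] with [a]
    prime to [Q'].  Every [theta] in D^(2)(Q) maps [a^2] to a multiple of [a]; if
    [theta] is invariant, then [theta(a^2)] is moreover fixed by [s], whereas
    [s a = - a], so that it is even a multiple of [a^2].  Hence the S-span of the
    invariant elements maps [a^2] into [a^2 S].  But [Q d^2/dx_0^2] lies in
    D^(2)(Q) and maps [a^2] to [2 Q], which is not a multiple of [a^2]. *)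

Set Implicit Arguments.
Unset Strict Implicit.
Unset Printing Implicit Defensive.

Import Order.TTheory GRing.Theory Num.Theory.
Local Open Scope ring_scope.

(** * Substitution and divisibility by [x_i - x_j] *)

Lemma comp_mpoly_congr (R : comNzRingType) (n k : nat)
    (lp lq : n.-tuple {mpoly R[k]}) (a : {mpoly R[k]}) :
    (forall i, exists h, tnth lp i = tnth lq i + a * h) ->
  forall p : {mpoly R[n]}, exists h, p \mPo lp = p \mPo lq + a * h.
Proof.
(* Congruence modulo [a] passes from variables to powers, monomials and sums; each witness collects
   the terms containing [a] in an expanded product [(u + a h) (v + a h')]. *)
move=> eq_lpq; elim/mpolyind=> [|c m p _ _ [hp IHp]].
  by exists 0; rewrite !comp_mpoly0 mulr0 addr0.
have [hm eq_m] : exists h, 'X_[m] \mPo lp = 'X_[m] \mPo lq + a * h.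
  rewrite !comp_mpolyX.
  elim/big_rec2: _ => [|i x y _ [h ->]]; first by exists 0; rewrite mulr0 addr0.
  have [hi ->] := eq_lpq i.
  have [hX ->] : exists h, (tnth lq i + a * hi) ^+ m i = tnth lq i ^+ m i + a * h.
    elim: (m i) => [|e [he IHe]]; first by exists 0; rewrite !expr0 mulr0 addr0.
    by exists (tnth lq i * he + hi * tnth lq i ^+ e + a * hi * he);
      rewrite !exprS IHe; ring.
  by exists (tnth lq i ^+ m i * h + hX * x + a * hX * h); ring.
exists (c%:MP * hm + hp); rewrite !comp_mpolyD !comp_mpolyZ eq_m IHp.
by rewrite -!mul_mpolyC; ring.
Qed.

Section Collapse.
Variables (R : idomainType) (n : nat) (i j : 'I_n).

(** Restriction to the hyperplane [x_i = x_j], encoded as an endomorphism of the polynomial ring so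
    that its values stay in the same integral domain. *)
Definition collapse : n.-tuple {mpoly R[n]} :=
  [tuple 'X_(if k == i then j else k) | k < n].

(** Modulo [x_i - x_j], collapsing agrees with the identity substitution, so [f] is congruent to its
    collapse. *)
Lemma collapse_root (f : {mpoly R[n]}) :
  f \mPo collapse = 0 -> exists h, f = ('X_i - 'X_j) * h.
Proof.
move=> f0.
have [k|h] := @comp_mpoly_congr R n n [tuple 'X_k | k < n] collapse
                ('X_i - 'X_j) _ f; last first.
  by rewrite comp_mpoly_id f0 add0r; exists h.
rewrite !tnth_mktuple; case: eqP => [->|_].
  by exists 1; rewrite mulr1 addrC subrK.
by exists 0; rewrite mulr0 addr0.
Qed.

Lemma comp_collapse_X k :
  'X_k \mPo collapse = 'X_(if k == i then j else k).
Proof. by rewrite comp_mpolyXU -tnth_nth tnth_mktuple. Qed.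

Lemma comp_collapse_diff : ('X_i - 'X_j) \mPo collapse = 0.
Proof. by rewrite comp_mpolyB !comp_collapse_X eqxx; case: ifP; rewrite subrr. Qed.

End Collapse.

(** * Second-order operators modulo [a] *)

Lemma mdeg2P (n : nat) (m : 'X_{1..n}) :
  mdeg m = 2%N -> exists i j, m = (U_(i) + U_(j))%MM.
Proof.
move=> m2; have [i mi] : exists i, m i != 0%N.
  apply/existsP; apply: contra_eqT m2; rewrite negb_exists => /forallP m0.
  by rewrite mdegE big1 // => i _; apply/eqP; rewrite -[_ == _]negbK.
have eq_m : (m - U_(i) + U_(i))%MM = m by apply: submK; rewrite lep1mP.
have /mdeg1P[j /eqP mj] : mdeg (m - U_(i)) == 1%N.
  by rewrite -(eqn_add2r (mdeg U_(i))) -mdegD eq_m m2 mdeg1.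
by exists i, j; rewrite -eq_m mj addmC.
Qed.

(** In the Leibniz expansion, a term with at least one derivative on [g] has at most one on
    [a ^+ 2], hence keeps a factor [a]. *)
Lemma mderivm2_sqrM (R : comNzRingType) (n : nat) (m : 'X_{1..n})
    (a g : {mpoly R[n]}) : mdeg m = 2%N ->
  exists h, (a ^+ 2 * g)^`M[m] = (a ^+ 2)^`M[m] * g + a * h.
Proof.
case/mdeg2P=> i [j ->].
exists (a^`M(i) * g^`M(j) *+ 2 + a^`M(j) * g^`M(i) *+ 2 + a * g^`M(i)^`M(j)).
by rewrite !mderivmDm !mderivmU1m !expr2 !(mderivM, mderivD); ring.
Qed.

Lemma diffop_sqrM (R : realType) (n : nat) (theta : D2S R n) (a g : {mpoly R[n]}) :
  exists h, diffop theta (a ^+ 2 * g) = diffop theta (a ^+ 2) * g + a * h.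
Proof.
have /fin_all_exists[h eq_h] (m : multi_index2 n) : exists h,
    (a ^+ 2 * g)^`M[val (val m)] = (a ^+ 2)^`M[val (val m)] * g + a * h.
  by apply: mderivm2_sqrM; apply/eqP/(valP m).
exists (\sum_m (theta m : {mpoly R[n]}) * h m).
rewrite /diffop mulr_suml mulr_sumr -big_split; apply: eq_bigr => m _ /=.
by rewrite eq_h; ring.
Qed.

(** * Action of permutations and of the reflection exchanging [x_i] and [x_j] *)

Lemma invmx_perm_mx (R : comUnitRingType) (n : nat) (s : 'S_n) :
  invmx (perm_mx s) = perm_mx s^-1 :> 'M[R]_n.
Proof.
by rewrite -[LHS]mulmx1 -(perm_mx1 R n) -(mulgV s) perm_mxM mulKmx ?unitmx_perm.
Qed.

Lemma lin_act_perm_mx (R : realType) (n : nat) (s : 'S_n) (f : {mpoly R[n]}) :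
  lin_act (perm_mx s) f = f \mPo [tuple 'X_((s^-1)%g i) | i < n].
Proof.
rewrite /lin_act; congr (_ \mPo _); apply: eq_mktuple => i.
rewrite invmx_perm_mx (bigD1 ((s^-1)%g i)) //= big1 => [|j ne_j].
  by rewrite !mxE eqxx scale1r addr0.
by rewrite !mxE eq_sym (negPf ne_j) scale0r.
Qed.

Lemma reflection_group_perm_mx (R : realType) (n : nat) (t : reflection_type)
  (s : 'S_n) : reflection_group t (perm_mx s : 'M[R]_n).
Proof.
have eq_s : perm_mx s = signed_perm_mx R s set0.
  rewrite /signed_perm_mx (_ : \row__ _ = const_mx 1) ?diag_const_mx ?mulmx1 //.
  by apply/rowP => i; rewrite !mxE inE.
case: t => /=; [by exists s | by exists s, set0 | exists s, set0].
by rewrite cards0.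
Qed.

Lemma var_diff_neq0 (R : nzRingType) (n : nat) (i j : 'I_n) :
  i != j -> 'X_i - 'X_j != 0 :> {mpoly R[n]}.
Proof.
apply: contraNneq => /(congr1 (mcoeff U_(i))).
rewrite mcoeffB !mcoeffXU mcoeff0 eqxx eq_sym.
by case: eqP => // _ /eqP; rewrite subr0 oner_eq0.
Qed.

Section Reflection.
Variables (R : realType) (n : nat) (i j : 'I_n).
Hypothesis ne_ij : i != j.

Local Notation a := ('X_i - 'X_j : {mpoly R[n]}).

Let swap (f : {mpoly R[n]}) := lin_act (perm_mx (tperm i j)) f.

Lemma swap_diff : swap a = - a.
Proof.
rewrite /swap lin_act_perm_mx tpermV comp_mpolyB !comp_mpolyXU -!tnth_nth.
by rewrite !tnth_mktuple tpermL tpermR opprB.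
Qed.

(** The reflection fixes the hyperplane [a = 0] pointwise. *)
Lemma swap_congr f : exists h, swap f = f + a * h.
Proof.
have [k|h] := @comp_mpoly_congr R n n [tuple 'X_(tperm i j k) | k < n]
                [tuple 'X_k | k < n] a _ f; last first.
  by rewrite comp_mpoly_id /swap lin_act_perm_mx tpermV; exists h.
rewrite !tnth_mktuple; case: tpermP => [->|->|_ _].
- by exists (-1); ring.
- by exists 1; ring.
by exists 0; rewrite mulr0 addr0.
Qed.

(** Since [a] changes sign, [f] must too; comparing [swap f = - f] with [swap f = f + a * h] gives
    [2 f = - a h], and 2 is invertible. *)
Lemma swap_fixed_dvd f : swap (a * f) = a * f -> exists h, f = a * h.
Proof.
have -> : swap (a * f) = - a * swap f.
  by rewrite -swap_diff /swap /lin_act rmorphM.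
rewrite mulNr -mulrN => /(mulfI (var_diff_neq0 R ne_ij)) swap_f.
have [h eq_h] := swap_congr f.
have two_f : 2%:R * f = a * - h.
  by rewrite mulr_natl mulr2n mulrN -(addKr f (a * h)) -eq_h opprD opprK swap_f.
exists ((2%:R^-1)%:MP * - h); rewrite mulrCA -two_f mulrA -mpolyC_nat -mpolyCM.
by rewrite mulVf ?mpolyC1 ?mul1r // pnatr_eq0.
Qed.

Lemma invariant_dvd (q : {mpoly R[n]}) (theta : D2S R n) :
    q \mPo collapse R i j != 0 -> D2 (a * q) theta ->
    op_act (perm_mx (tperm i j)) (diffop theta) =1 diffop theta ->
  exists h, diffop theta (a ^+ 2) = a ^+ 2 * h.
Proof.
move=> q0 D2theta inv_theta.
have [g eq_g] := D2theta a.
have [h eq_h] := diffop_sqrM theta a q.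
(* As [(a q) a = a^2 q], membership in [D2] tested on [a], with the Leibniz congruence, shows that
   [a] divides [theta(a^2) q]. Collapsing [q] gives a nonzero element of a domain, which can be
   cancelled. *)
have [F eq_F] : exists F, diffop theta (a ^+ 2) = a * F.
  apply: collapse_root; apply: (mulIf q0); rewrite mul0r -rmorphM.
  have -> : diffop theta (a ^+ 2) * q = a * (q * g - h).
    rewrite -[LHS](addrK (a * h)) -eq_h (_ : a ^+ 2 * q = a * q * a); last by ring.
    by rewrite eq_g; ring.
  by rewrite rmorphM /= comp_collapse_diff mul0r.
(* The reflection fixes [a^2], so by invariance of [theta] it fixes [theta(a^2) = a F]. *)
have [G eq_G] : exists G, F = a * G.
  apply: swap_fixed_dvd; rewrite -eq_F /swap -[in RHS]inv_theta /op_act.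
  rewrite invmx_perm_mx tpermV.
  suff -> : lin_act (perm_mx (tperm i j)) (a ^+ 2) = a ^+ 2 by [].
  by rewrite /lin_act rmorphXn /= -/(lin_act _ a) -/(swap a) swap_diff sqrrN.
by exists G; rewrite eq_F eq_G mulrA.
Qed.

End Reflection.

(** * The defining polynomial has [x_0 - x_1] as a simple factor *)

(* A point of the hyperplane x_0 = x_1 lying on no other reflecting hyperplane. *)
Definition collapsed_point (R : realType) (n : nat) (i : 'I_n) : R :=
  (maxn i 1)%:R.

Lemma prod_pairs_split (R : comNzRingType) (S : idomainType) (n : nat)
   (F : 'I_n -> 'I_n -> R) (f : {rmorphism R -> S}) (i j : 'I_n) :
    (i < j)%N ->
    (forall k m : 'I_n, (k < m)%N -> (k, m) != (i, j) -> f (F k m) != 0) ->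
  exists q, \prod_(k < n) \prod_(m < n | (k < m)%N) F k m = F i j * q /\ f q != 0.
Proof.
move=> lt_ij F0.
exists ((\prod_(m < n | (i < m)%N && (m != j)) F i m) *
  \prod_(k < n | k != i) \prod_(m < n | (k < m)%N) F k m).
split; first by rewrite (bigD1 i) //= (bigD1 j) //= mulrA.
rewrite rmorphM mulf_neq0 // rmorph_prod; apply/prodf_neq0 => k.
  by case/andP=> lt_ik ne_kj; apply: F0; rewrite // xpair_eqE eqxx.
move=> ne_ki; rewrite rmorph_prod; apply/prodf_neq0 => m lt_km.
by apply: F0; rewrite // xpair_eqE (negPf ne_ki).
Qed.

Lemma defining_poly_simple_root (R : realType) (t : reflection_type) (n : nat)
    (i j : 'I_n) : i = 0%N :> nat -> j = 1%N :> nat ->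
  exists q, defining_poly R n t = ('X_i - 'X_j) * q /\
            q.@[@collapsed_point R n] != 0.
Proof.
move=> i0 j1; set v := @collapsed_point R n.
(* The point is [(1, 1, 2, 3, ...)]: its coordinates are positive, and only the first two
   coincide. *)
have v0 k m : (v k + v m != 0) && (v k != 0).
  by rewrite /v /collapsed_point -natrD !pnatr_eq0; lia.
have neq_v (k m : 'I_n) : (k < m)%N -> (k, m) != (i, j) -> v k - v m != 0.
  by rewrite subr_eq0 eqr_nat xpair_eqE -!val_eqE /= i0 j1; lia.
have lt_ij : (i < j)%N by rewrite i0 j1.
have [|q2 [eq_q2 q2_0]] := @prod_pairs_split _ _ n
   (fun k m => 'X_k ^+ 2 - 'X_m ^+ 2 : {mpoly R[n]}) (meval v) i j lt_ij.
  move=> k m lt_km ne_km /=; rewrite subr_sqr mevalM mevalB mevalD !mevalXU.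
  by rewrite mulf_neq0 ?neq_v //; case/andP: (v0 k m).
(* In types B and D the pair [(i, j)] contributes [x_i^2 - x_j^2], whose cofactor [x_i + x_j] goes
   into [q]. *)
have Xij0 : ('X_i + 'X_j : {mpoly R[n]}).@[v] != 0.
  by rewrite mevalD !mevalXU; case/andP: (v0 i j).
case: t => /=.
- have [|q [-> q0]] := @prod_pairs_split _ _ n
   (fun k m => 'X_k - 'X_m : {mpoly R[n]}) (meval v) i j lt_ij; last by exists q.
  by move=> k m lt_km ne_km /=; rewrite mevalB !mevalXU neq_v.
- exists ((\prod_(k < n) 'X_k) * (('X_i + 'X_j) * q2)); split.
    by rewrite eq_q2 subr_sqr; ring.
  rewrite !mevalM !mulf_neq0 // rmorph_prod; apply/prodf_neq0 => k _ /=.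
  by rewrite mevalXU; case/andP: (v0 k k).
- exists (('X_i + 'X_j) * q2); split; last by rewrite mevalM mulf_neq0.
  by rewrite eq_q2 subr_sqr mulrA.
Qed.

(** * The operator [Q d^2/dx_i^2] and the contradiction *)

Definition D2S_sqr_partial (R : realType) (n : nat) (Q : {mpoly R[n]})
    (i : 'I_n) : D2S R n :=
  [ffun m : multi_index2 n => if val (val m) == (U_(i) *+ 2)%MM then Q else 0].

Lemma diffop_sqr_partial (R : realType) (n : nat) (Q f : {mpoly R[n]}) (i : 'I_n) :
  diffop (D2S_sqr_partial Q i) f = Q * f^`M[U_(i) *+ 2].
Proof.
have m2 : mdeg (U_(i) *+ 2 : 'X_{1..n}) == 2%N by rewrite mdegMn mdeg1.
have lt_m : (mdeg (U_(i) *+ 2 : 'X_{1..n}) < 3)%N by rewrite (eqP m2).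
rewrite /diffop (bigD1 (Sub (BMultinom lt_m) m2 : multi_index2 n)) //= ffunE eqxx.
rewrite big1 ?addr0 // => m ne_m.
by rewrite ffunE ifN ?mul0r.
Qed.

Lemma mderivm2_sqr (R : comNzRingType) (n : nat) (i : 'I_n) (a : {mpoly R[n]}) :
  a^`M(i) = 1 -> (a ^+ 2)^`M[U_(i) *+ 2] = 2%:R.
Proof.
move=> da; rewrite mulmS mulm1n mderivmDm !mderivmU1m expr2.
by rewrite !(mderivM, mderivD) da -mpolyC1 mderivC mpolyC1; ring.
Qed.

Theorem theorem6p5 (R : realType) (t : reflection_type) (l : nat)
    (hl : (min_dim t <= l)%N) :
  ~ exists B : D2S R l -> Prop,
      is_basis (D2 (defining_poly R l t)) B /\
      (forall theta, B theta ->
         invariant_op (reflection_group (R := R) (l := l) t) theta).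
Proof.
case=> B [[B_D2 B_span _] B_inv].
have l2 : (1 < l)%N by apply: leq_trans hl; case: t {B_D2 B_span B_inv}.
pose i := Ordinal (ltnW l2); pose j := Ordinal l2.
pose a : {mpoly R[l]} := 'X_i - 'X_j.
have [q [eq_Q q0]] := @defining_poly_simple_root R t l i j erefl erefl.
have vij : collapsed_point R i = collapsed_point R j by [].
(* Collapsing does not change the value at [collapsed_point], whose first two coordinates agree, and
   [q] is nonzero there. *)
have q'0 : q \mPo collapse R i j != 0.
  apply: contraNneq q0 => /(congr1 (meval (@collapsed_point R l))).
  rewrite comp_mpoly_meval meval0 => <-; apply/eqP/meval_eq => k.
  by rewrite tnth_mktuple mevalXU; case: eqP => [->|].
have a2_dvd theta : B theta -> exists h, diffop theta (a ^+ 2) = a ^+ 2 * h.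
  move=> Btheta; apply: (@invariant_dvd _ _ i j _ q) => //.
    by rewrite -eq_Q; apply: B_D2.
  exact/B_inv/reflection_group_perm_mx.
pose theta0 := D2S_sqr_partial (defining_poly R l t) i.
have [|s [c [sB eq_theta0]]] := B_span theta0.
  by move=> f; eexists; rewrite diffop_sqr_partial.
(* Evaluation at [a ^+ 2] is S-linear in the operator, so divisibility by [a ^+ 2] extends from [B]
   to its span. *)
have [h eq_h] : exists h, diffop theta0 (a ^+ 2) = a ^+ 2 * h.
  rewrite eq_theta0; elim: s sB {eq_theta0} => [|b s IHs] sB.
    exists 0; rewrite big_nil mulr0 /diffop big1 // => m _.
    by rewrite ffunE mul0r.
  have [|h eq_h] := IHs; first by move=> b' b's; apply: sB; rewrite inE b's orbT.
  have [hb eq_hb] := a2_dvd b (sB b (mem_head b s)).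
  exists (c b * hb + h); rewrite big_cons mulrDr -eq_h mulrCA -eq_hb.
  rewrite /diffop mulr_sumr -big_split; apply: eq_bigr => m _ /=.
  by rewrite !ffunE mulrDl mulrA.
move: eq_h; rewrite diffop_sqr_partial eq_Q.
have -> : (a ^+ 2)^`M[U_(i) *+ 2] = 2%:R.
  apply: mderivm2_sqr; rewrite mderivB !mderivX !mnm1E eqxx scale1r scale0r subr0.
  by rewrite -mpolyX0; congr 'X_[_]; apply/mnmP => k; rewrite mnmBE subnn mnm0E.
have a0 : a != 0 by rewrite var_diff_neq0.
(* Cancelling one [a] in [2 a q = a^2 h] leaves [2 q = a h]; at [collapsed_point] the right side
   vanishes and the left side does not. *)
rewrite expr2 -!mulrA => /(mulfI a0) /(congr1 (meval (@collapsed_point R l))).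
rewrite !mevalM mevalB !mevalXU vij subrr mul0r => /eqP.
by rewrite mulf_eq0 (negPf q0) -mpolyC_nat mevalC pnatr_eq0.
Qed.
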